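(* Let $(\vec{G},c)$ be a connected edge-weighted symmetric digraph (with at least one arc) all of whose arc weights $c_{uv}$ are positive integers. Then $$\chi_c(\vec{G},c)=\min_{T}\frac{p_{(\vec{G},c,T)}}{m_{(\vec{G},c,T)}},$$ where the minimum is taken over all good initial markings $T$ of $(\vec{G},c)$, and $p_{(\vec{G},c,T)}$ and $m_{(\vec{G},c,T)}$ are the period and the multiplicity of the timed marked graph $(\vec{G},c,T)$.
   Context: An edge-weighted digraph $(\vec{G},c)$ is a finite directed graph $\vec{G}$ together with an assignment $c$ of a positive real weight $c_{uv}$ to each arc $uv$ (the directed edge from $u$ to $v$; it is an in-arc of $v$ and an out-arc of $u$). It is symmetric if for all vertices $u,v$, the arc $uv$ exists if and only if the arc $vu$ exists. Connected refers to the underlying graph. A dicycle is a closed directed walk with no repeated vertices except that the beginning vertex equals the ending vertex (the 2-cycle $u\to v\to u$ is allowed). Circular chromatic number. For a real $p>0$ let $S^p$ be a circle of perimeter $p$, identified with $[0,p)$. For $x,y\in S^p$ let $d(x,y)$ be the length of the arc of $S^p$ from $x$ to $y$ in the clockwise direction (the direction of increasing parameter in $[0,p)$) if $x\neq y$, and $d(x,x)=0$. A circular $p$-coloring of $(\vec{G},c)$ is a map $\varphi:V(\vec{G})\to S^p$ with $d(\varphi(u),\varphi(v))\ge c_{uv}$ for every arc $uv$. Then $\chi_c(\vec{G},c)=\inf\{p: (\vec{G},c)\text{ has a circular }p\text{-coloring}\}$. Markings. An initial marking $T$ assigns a nonnegative integer $T_{uv}$ (number of tokens) to each arc $uv$;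 $(\vec{G},c,T)$ is then called a timed marked graph. For a dicycle $C$, $|C|_T=\sum_{uv\in E(C)}T_{uv}$. On a symmetric digraph $T$ is good if $|C|_T>0$ for every dicycle $C$ and $T_{uv}+T_{vu}=1$ for every arc $uv$. Token game. Time is discrete, $t\in\{1,2,3,\dots\}$, and the token distribution before any firing is $T$. A vertex $u$ is fireable at time $t$ if every in-arc of $u$ contains at least one token at time $t$. At every time $t$ all fireable vertices are fired simultaneously. When $u$ fires at time $t$ it removes one token from each of its in-arcs at time $t$, and for each out-arc $uv$ it places one token on $uv$ at time $t+c_{uv}$ (this token is available at time $t+c_{uv}$ and not earlier). Let $h(t)$ be the set of vertices fireable at time $t$ (possibly empty). There exist positive integers $p$ and $M$ with $h(t+p)=h(t)$ for all $t\ge M$; the smallest such $p$ is the period $p_{(\vec{G},c,T)}$. With $p$ this smallest value, the number of times a vertex $u$ becomes fireable (i.e. the number of $t$ with $u\in h(t)$) in the time interval $[M,M+p)$ is the same for all vertices $u$; this common number is the multiplicity $m_{(\vec{G},c,T)}$. *)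

(* Defs.v *)
From mathcomp Require Import all_boot all_order all_algebra.
From mathcomp Require Import all_classical all_reals.

Set Implicit Arguments.
Unset Strict Implicit.
Unset Printing Implicit Defensive.

Import Order.TTheory GRing.Theory Num.Theory.
Local Open Scope ring_scope.

(* Throughout, a digraph is [e : rel V] on a finite type; arc weights and
   markings are total functions [V -> V -> _] whose values off the arcs are
   never used. *)

Definition weakly_connected (V : finType) (e : rel V) : Prop :=
  forall u v, connect (relU e (fun x y => e y x)) u v.

Section CircularColoring.
Variables (R : realType) (V : finType) (e : rel V) (c : V -> V -> R).

(* Clockwise distance on the circle of perimeter p, identified with [0, p). *)
Definition circ_dist (p x y : R) : R :=
  if x <= y then y - x else p - x + y.

Definition circular_coloring (p : R) (phi : V -> R) : Prop :=
  (forall v, 0 <= phi v < p) /\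
  (forall u v, e u v -> c u v <= circ_dist p (phi u) (phi v)).

(* [inf] is 0 on the empty set, but a finite loopless digraph always has a
   circular p-coloring for p large enough. *)
Definition circular_chromatic_number : R :=
  inf [set p : R | 0 < p /\ exists phi, circular_coloring p phi]%classic.

End CircularColoring.

Section Marking.
Variables (V : finType) (e : rel V) (T : V -> V -> nat).

(* A dicycle is given by its sequence of distinct vertices; its arcs go from
   each vertex to the cyclically next one. *)
Definition dicycle (C : seq V) : bool := [&& C != [::], cycle e C & uniq C].

Definition cycle_tokens (C : seq V) : nat := (\sum_(u <- C) T u (next C u))%N.

Definition good_marking : Prop :=
  (forall C, dicycle C -> (0 < cycle_tokens C)%N) /\
  (forall u v, e u v -> (T u v + T v u)%N = 1%N).

End Marking.

Section TokenGame.
Local Open Scope nat_scope.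
Variables (V : finType) (e : rel V) (c : V -> V -> nat) (T : V -> V -> nat).

(* [s u v k] is the number of tokens of the arc uv that become available k
   time units from now; in particular [s u v 0] tokens are available now. *)
Definition state := V -> V -> nat -> nat.

Definition initial_state : state := fun u v k => if k is 0 then T u v else 0.

Definition fireable (s : state) (v : V) : bool :=
  [forall u, e u v ==> (0 < s u v 0)].

(* The subtraction never truncates on an arc: a fireable vertex has a token
   available on each of its in-arcs. *)
Definition fire (s : state) : state := fun u v k =>
  s u v k - ((k == 0) && fireable s v) + ((k == c u v) && fireable s u).

Definition tick (s : state) : state := fun u v k =>
  if k is 0 then s u v 0 + s u v 1 else s u v k.+1.

(* Time starts at 1; the value at time 0 is not meaningful. *)
Definition state_at (t : nat) : state :=
  iter t.-1 (fun s => tick (fire s)) initial_state.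

Definition fired_at (t : nat) : {set V} :=
  [set v | fireable (state_at t) v]%SET.

Definition periodic_from (p M : nat) : Prop :=
  [/\ 0 < p, 0 < M & forall t, M <= t -> fired_at (t + p) = fired_at t].

Definition is_period (p : nat) : Prop :=
  (exists M, periodic_from p M) /\
  (forall q, (exists M, periodic_from q M) -> p <= q).

(* [period] and [multiplicity] default to 0 if no value qualifies. *)
Definition period : nat := xget 0 is_period.

Definition is_multiplicity (m : nat) : Prop :=
  exists2 M, periodic_from period M &
    forall u, count (fun t => u \in fired_at t) (iota M period) = m.

Definition multiplicity : nat := xget 0 is_multiplicity.

End TokenGame.

(* Main.v *)
Require Import Defs.
From mathcomp Require Import all_boot all_order all_algebra.
From mathcomp Require Import all_classical all_reals.
From mathcomp Require Import zify ring lra.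

Set Implicit Arguments.
Unset Strict Implicit.
Unset Printing Implicit Defensive.

Import Order.TTheory GRing.Theory Num.Theory.

(** The value [period / multiplicity] of the token game on a good marking [T] is
    compared with the perimeters of circular colorings in both directions.

    Write [N n v] for the number of firings of [v] during the first [n] time
    units ([firings]). Counting tokens turns the game into the recurrence: [v]
    fires at time [n + 1] if and only if [N n v < T u v + N (n + 1 - c u v) u]
    for every in-arc [uv] ([state_formula]). Since [T u v + T v u = 1], the
    tokens of the two arcs between [u] and [v], those under way included,
    always add up to one, so the game is a deterministic process on finitely
    many states and is eventually periodic.
    The counts of adjacent vertices stay within one of each other, so all
    vertices fire equally often in a period; as no dicycle is free of tokens
    the game never stops, so this number is positive. Hence eventually
    [N (n + p) v = N n v + m] with [p] the period and [m] the multiplicity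
    ([game_growth]).

    From markings to colorings ([growth_coloring]). Every firing of [v] needs
    its tokens, so [N n v <= T u v + N (n - c u v) u]. Summed over a period
    starting late enough, with [S v] the sum of the [N n v], this becomes
    [S v <= p T u v + S u - m c u v]. So the potential [y v = - S v / m]
    satisfies [c u v <= y v - y u + T u v * (p / m)], and as [T u v + T v u = 1]
    its residues modulo [p / m] are a circular coloring
    ([potential_circular_coloring]).

    From colorings to markings ([growth_le_perimeter]). A coloring [phi] of
    perimeter [p] orders the vertices; put a token on [uv] exactly when
    [phi v < phi u], so that [c u v <= phi v - phi u + T u v * p]. This marking
    is good, as every dicycle must descend somewhere. By induction on time, the
    firing number [k] of [v], counted from 0, has taken place at every integer
    time from [phi v + k p + 1] on ([coloring_schedule]), so the game is at
    least as fast as one firing per [p] time units: period over multiplicity is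
    at most [p].

    Only finitely many markings take the values 0 and 1, so one of the good
    ones among them minimizes the ratio; the minimum is both the perimeter of a
    coloring and a lower bound of all perimeters, hence is their infimum. *)

(** * Markings and dicycles *)

Lemma finType_collision (U : finType) (f : nat -> U) :
  exists i j, i < j /\ f i = f j.
Proof.
have /injectivePn[i [j nij eqij]] : ~~ injectiveb (fun i : 'I_#|U|.+1 => f i).
  by apply/negP => /injectiveP /leq_card; rewrite card_ord ltnn.
case: (ltngtP i j) => [lij|lji|/val_inj eij].
- by exists i, j.
- by exists j, i.
- by rewrite eij eqxx in nij.
Qed.

Lemma big_next (U : eqType) (A : Type) (idx : A) (op : Monoid.com_law idx)
    (C : seq U) (F : U -> A) :
  uniq C -> \big[op/idx]_(u <- C) F (next C u) = \big[op/idx]_(u <- C) F u.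
Proof.
move=> uC; rewrite -(big_map (next C) predT F); apply: perm_big.
have inj : injective (next C) by apply: can_inj (prev_next uC).
apply: uniq_perm; rewrite ?(map_inj_uniq inj) // => x.
by rewrite -{1}(next_prev uC x) (mem_map inj) mem_prev.
Qed.

(** Here [T u v + a u - a v] is to be thought of as the number of tokens on [uv]
    after each vertex [w] has fired [a w] times, and [f v] as the source of an
    empty in-arc of [v]. The iterates of [f] run into a dicycle of empty arcs;
    since firing does not change the number of tokens of a dicycle, that
    dicycle was empty from the start. *)
Lemma good_marking_deadlock_free (V : finType) (e : rel V) (T : V -> V -> nat)
    (a : V -> nat) (f : V -> V) (v0 : V) :
  good_marking e T ->
  ~ (forall v, e (f v) v /\ a v = T (f v) v + a (f v)).
Proof.
move=> [live _] stuck.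
have [y Hy] : exists y, exists k, iter k.+1 f y = y.
  have [i [j [lij eqij]]] := finType_collision (fun i => iter i f v0).
  exists (iter i f v0), (j - i).-1.
  by rewrite prednK ?subn_gt0 // -iterD subnK // ltnW.
have cyc : fcycle f (orbit f y) by apply/(orbitPcycle 3 0).
have uO := orbit_uniq f y.
(* [f] runs against the arcs, hence the reversal *)
set C := rev (orbit f y).
have uC : uniq C by rewrite rev_uniq.
have nextC u : u \in C -> f (next C u) = u.
  rewrite mem_rev => uin; rewrite next_rev //.
  by apply/eqP; apply: (prev_cycle (e := frel f)).
have dC : dicycle e C.
  apply/and3P; split=> //.
  - by rewrite -size_eq0 size_rev size_orbit -lt0n order_gt0.
  - rewrite rev_cycle; apply: sub_cycle cyc => x z /eqP <-.
    by case: (stuck x).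
have := live C dC; rewrite /cycle_tokens.
have : (\sum_(u <- C) (T u (next C u) + a u) = \sum_(u <- C) a u)%N.
  rewrite -[RHS](big_next _ _ uC); apply: eq_big_seq => u uin.
  by case: (stuck (next C u)) => _ ->; rewrite nextC.
rewrite big_split /=; lia.
Qed.

(** On a dicycle, the arc leaving a vertex that maximizes [phi] carries a
    token. *)
Lemma order_marking_good (d : Order.disp_t) (U : orderType d) (V : finType)
    (e : rel V) (phi : V -> U) (T : V -> V -> nat) :
  (forall u v, e u v -> phi u != phi v) ->
  (forall u v, T u v = (phi v < phi u)%O) ->
  good_marking e T.
Proof.
move=> neq TE; split=> [C /and3P[C0 cC uC]|u v euv]; last first.
  by rewrite !TE; case: ltgtP (neq u v euv).
have [x0 x0C] : exists x, x \in C.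
  by case: C C0 {cC uC} => // x C _; exists x; rewrite mem_head.
have [x xC maxx] := Order.TotalTheory.arg_maxP phi x0C.
have nxC : next C x \in C by rewrite mem_next.
rewrite /cycle_tokens (big_rem x) //= TE lt_neqAle.
by rewrite (maxx _ nxC : (_ <= _)%O) eq_sym neq // (next_cycle cC).
Qed.

(** * Firing counts *)

Section FiringCounts.
Local Open Scope nat_scope.
Variables (V : finType) (e : rel V) (c : V -> V -> nat) (T : V -> V -> nat).
Hypothesis c_pos : forall u v, e u v -> 0 < c u v.

(** Steps are counted from 0, so that step [n] is time [n.+1]. *)
Definition firing (n : nat) (v : V) : bool :=
  fireable e (state_at e c T n.+1) v.

(** The number of firings of [v] strictly before step [n], that is, during the
    times 1, ..., n. *)
Definition firings (n : nat) (v : V) : nat := \sum_(0 <= i < n) firing i v.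

Lemma firingsS n v : firings n.+1 v = firings n v + firing n v.
Proof. by rewrite /firings big_nat_recr. Qed.

Lemma firings0 v : firings 0 v = 0.
Proof. by rewrite /firings big_geq. Qed.

Lemma leq_firings m n v : m <= n -> firings m v <= firings n v.
Proof.
by move=> /subnK <-; elim: (n - m) => // k; rewrite addSn firingsS; lia.
Qed.

Lemma weights_bounded : exists K, forall u v, c u v <= K.
Proof.
exists (\max_u \max_v c u v) => u v.
by apply: leq_trans (leq_bigmax u); apply: (leq_bigmax v).
Qed.

Lemma fired_atE t v : 0 < t -> (v \in fired_at e c T t) = firing t.-1 v.
Proof. by case: t => // n _; rewrite inE. Qed.

(** A token put on [uv] by a firing of [u] at step [i] becomes available at step
    [i + c u v]. So the available tokens are the initial ones and those of the
    firings at steps up to [n - c u v], minus those used by [v]; the token due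
    in [k.+1] steps comes from the firing at step [n + k.+1 - c u v], which must
    exist and lie in the past. *)
Lemma state_formula n u v : e u v ->
  state_at e c T n.+1 u v 0 + firings n v = T u v + firings (n.+1 - c u v) u /\
  (forall k, state_at e c T n.+1 u v k.+1 =
     [&& k.+1 < c u v, c u v <= n + k.+1 & firing (n + k.+1 - c u v) u]).
Proof.
move=> euv; have cuv := c_pos euv; elim: n => [|n [IH0 IHS]].
  rewrite firings0 /= (_ : 1 - c u v = 0) ?firings0; last lia.
  by split=> // k; case: ltnP => //= ?; case: leqP => //; lia.
have stE : state_at e c T n.+2 = tick (fire e c (state_at e c T n.+1)) by [].
rewrite stE /tick /fire !eqxx /= -/(firing n v) -/(firing n u); split.
  have fle : firing n v <= state_at e c T n.+1 u v 0.
    rewrite /firing /fireable; case: forallP => // /(_ u).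
    by rewrite euv.
  rewrite IHS firingsS subn0.
  have [c1|c1|c1] := ltngtP 1 (c u v).
  - case: (leqP (c u v) n.+1) => cn; rewrite addn1 ?cn /=.
    + rewrite (subSn cn) firingsS; lia.
    + have -> : n.+2 - c u v = n.+1 - c u v by lia.
      lia.
  - lia.
  - rewrite -c1 /= in IH0 *.
    have -> : n.+2 - 1 = n.+1 by lia.
    rewrite subSS subn0 in IH0; rewrite firingsS; lia.
move=> k; rewrite IHS subn0.
have -> : n.+1 + k.+1 = n + k.+2 by lia.
case: (ltngtP k.+2 (c u v)) => kc.
- by rewrite addn0.
- by [].
- by rewrite -kc leq_addl addnK.
Qed.

(** The tokens used by [v] were available when it fired, so those produced by
    [u] left it at least [c u v] time units before. *)
Lemma firings_causal n u v : e u v ->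
  firings n v <= T u v + firings (n - c u v) u.
Proof.
case: n => [|n] euv; first by rewrite firings0.
have [S0 _] := state_formula n euv; rewrite firingsS.
have fle : firing n v <= state_at e c T n.+1 u v 0.
  rewrite /firing /fireable; case: forallP => // /(_ u).
  by rewrite euv.
lia.
Qed.

Lemma firing_enabled n v :
  (forall u, e u v -> firings n v < T u v + firings (n.+1 - c u v) u) ->
  firing n v.
Proof.
move=> en; apply/forallP => u; apply/implyP => euv.
have := en u euv; have [S0 _] := state_formula n euv; lia.
Qed.

Lemma firing_disabled n v : ~~ firing n v ->
  exists2 u, e u v & firings n v = T u v + firings (n.+1 - c u v) u.
Proof.
rewrite negb_forall => /existsP[u].
rewrite negb_imply -eqn0Ngt => /andP[euv /eqP s0].
by exists u => //; have [] := state_formula n euv; rewrite s0.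
Qed.

(** * Eventual periodicity *)

Lemma weakly_connected_const (A : Type) (f : V -> A) :
  weakly_connected e -> (forall u v, e u v -> f u = f v) ->
  forall u v, f u = f v.
Proof.
move=> conn loc u v; have /connectP[s pth ->] := conn u v.
elim: s u pth {conn} => //= w s IH u /andP[uw /IH <-].
by case/orP: uw => /loc.
Qed.

Hypothesis e_sym : symmetric e.
Hypothesis T_good : good_marking e T.

Lemma firings_arc n u v : e u v -> firings n v <= T u v + firings n u.
Proof.
move=> euv; apply: leq_trans (firings_causal n euv) _.
by rewrite leq_add2l leq_firings // leq_subr.
Qed.

Lemma state_le1 n u v k : e u v -> state_at e c T n.+1 u v k <= 1.
Proof.
move=> euv; have [S0 SS] := state_formula n euv.
case: k => [|k]; last by rewrite SS leq_b1.
have evu : e v u by rewrite e_sym.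
have := firings_arc n evu; have [_ /(_ u v euv)] := T_good.
have : firings (n.+1 - c u v) u <= firings n u.
  by apply: leq_firings; have := c_pos euv; lia.
lia.
Qed.

(** The game reads states on the arcs only, and only there do the token counts
    above control them. *)
Definition agree_on_arcs (s s' : state V) : Prop :=
  forall u v k, e u v -> s u v k = s' u v k.

Lemma agree_fireable s s' v :
  agree_on_arcs s s' -> fireable e s v = fireable e s' v.
Proof.
move=> ag; apply: eq_forallb => u.
by case euv: (e u v) => //=; rewrite ag.
Qed.

Lemma agree_step s s' :
  agree_on_arcs s s' -> agree_on_arcs (tick (fire e c s)) (tick (fire e c s')).
Proof.
move=> ag u v k euv; rewrite /tick /fire !(agree_fireable _ ag).
by case: k => [|k]; rewrite !ag.
Qed.

(** By [state_le1] and the bound on the weights, finitely many booleans encode a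
    state on the arcs. *)
Lemma state_recurs : exists i j, i < j /\
  agree_on_arcs (state_at e c T i.+1) (state_at e c T j.+1).
Proof.
have [K cK] := weights_bounded.
pose code n := [ffun x : V * V * 'I_K.+1 =>
  e x.1.1 x.1.2 && (0 < state_at e c T n.+1 x.1.1 x.1.2 x.2)].
have codeP i j : code i = code j ->
    agree_on_arcs (state_at e c T i.+1) (state_at e c T j.+1).
  move=> eqc u v k euv; case: (ltnP k K.+1) => [kK|Kk].
    have /ffunP/(_ (u, v, Ordinal kK)) := eqc.
    rewrite !ffunE /= euv /=.
    have := state_le1 i k euv; have := state_le1 j k euv; lia.
  (* nothing is ever under way for longer than the weight of its arc *)
  case: k Kk => // k Kk.
  rewrite !(proj2 (state_formula _ euv)).
  by have -> : (k.+1 < c u v) = false by have := cK u v; lia.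
have [i [j [lij eqij]]] := finType_collision code.
by exists i, j; split=> //; apply: codeP.
Qed.

Lemma firing_eventually_periodic :
  exists p B, 0 < p /\ forall n v, B <= n -> firing (n + p) v = firing n v.
Proof.
have [i [j [lij ag]]] := state_recurs.
exists (j - i), i; split=> [|n v /subnK <-]; first by rewrite subn_gt0.
have agk k : agree_on_arcs (state_at e c T (k + i).+1) (state_at e c T (k + j).+1).
  by elim: k => // k IH; apply: agree_step IH.
rewrite -addnA subnKC 1?ltnW //.
by apply: esym; apply: agree_fireable; apply: agk.
Qed.

Lemma firings_count n p v :
  firings (n + p) v
  = firings n v + count (fun t => v \in fired_at e c T t) (iota n.+1 p).
Proof.
elim: p => [|p IH]; first by rewrite !addn0.
rewrite addnS firingsS IH -[in RHS](addn1 p) iotaD count_cat /= fired_atE //.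
by rewrite addSn /= addn0 addnA.
Qed.

Lemma period_exists : exists p, is_period e c T p.
Proof.
have [p [B [p0 perB]]] := firing_eventually_periodic.
have ex : exists p, `[< exists M, periodic_from e c T p M >].
  exists p; apply/asboolP; exists B.+1; split=> // t Bt.
  apply/setP => v; rewrite !fired_atE; [|lia..].
  by rewrite (_ : (t + p).-1 = t.-1 + p) ?perB; lia.
case: (ex_minnP ex) => q /asboolP qper qmin.
by exists q; split=> // q' q'per; apply: qmin; apply/asboolP.
Qed.

(** Periodicity of the firing pattern, read as a linear growth of the firing
    counts; this growth is all that the comparison with colorings uses. *)
Definition grows_by (p : nat) (r : V -> nat) (B : nat) : Prop :=
  forall n v, B <= n -> firings (n + p) v = firings n v + r v.

Lemma grows_by_iter p r B j n v :
  grows_by p r B -> B <= n -> firings (n + j * p) v = firings n v + j * r v.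
Proof.
move=> gr Bn; elim: j => [|j IH]; first by rewrite !mul0n !addn0.
rewrite (_ : n + j.+1 * p = n + j * p + p); last by rewrite mulSn; lia.
by rewrite gr ?IH; [rewrite mulSn; lia|lia].
Qed.

Lemma periodic_grows_by p M : periodic_from e c T p M ->
  grows_by p (fun v => count (fun t => v \in fired_at e c T t) (iota M p)) M.-1.
Proof.
move=> [p0 M0 per] n v /subnK <-; elim: (n - _) => [|k IH].
  by rewrite add0n firings_count prednK.
rewrite !addSn !firingsS IH addnAC; congr (_ + nat_of_bool _ + _).
have /setP/(_ v) := per (k + M.-1).+1 ltac:(lia).
by rewrite !fired_atE // addSn.
Qed.

Lemma grows_by_same_rate p r B : weakly_connected e -> grows_by p r B ->
  forall u v, r u = r v.
Proof.
move=> conn gr.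
(* adjacent counts stay within a bounded distance of each other; if the rates
   differed, [j] periods would separate them by at least [j] *)
have rle u v : e u v -> r v <= r u.
  move=> euv; rewrite leqNgt; apply/negP => ruv.
  pose j := (T u v + firings B u).+1.
  have := firings_arc (B + j * p) euv; rewrite !(grows_by_iter _ _ gr) //.
  have : j * (r u).+1 <= j * r v by rewrite leq_mul2l ruv orbT.
  by rewrite mulnS /j; lia.
apply: weakly_connected_const conn _ => u v euv.
by apply/eqP; rewrite eqn_leq; apply/andP; split; apply: rle; rewrite // e_sym.
Qed.

(** If nothing fired any more, every token would eventually be available, and
    still each vertex would have an empty in-arc. *)
Lemma deadlock_free B : inhabited V ->
  ~ (forall n v, B <= n -> firings n v = firings B v).
Proof.
move=> [v0] const; have [K cK] := weights_bounded.
have stuck v : exists u, e u v /\ firings B v = T u v + firings B u.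
  have /firing_disabled[u euv] : ~~ firing (B + K) v.
    have := firingsS (B + K) v; rewrite !const; [lia|lia|lia].
  rewrite !const; [|have := cK u v; lia|lia].
  by exists u.
have [f fP] := choice stuck.
exact: (good_marking_deadlock_free v0 T_good fP).
Qed.

Lemma game_growth : weakly_connected e -> inhabited V ->
  [/\ 0 < period e c T, 0 < multiplicity e c T &
      exists B, grows_by (period e c T) (fun=> multiplicity e c T) B].
Proof.
move=> conn inh; have [v0] := inh.
have [[M perM] _] : is_period e c T (period e c T) := xgetPex 0 period_exists.
have [M' perM' cnt] : is_multiplicity e c T (multiplicity e c T).
  apply: (xgetPex 0); exists (count (fun t => v0 \in fired_at e c T t)
                              (iota M (period e c T))).
  exists M => // u; apply: grows_by_same_rate (periodic_grows_by perM) _ _.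
  exact: conn.
have [p0 _ _] := perM'.
have gr : grows_by (period e c T) (fun=> multiplicity e c T) M'.-1.
  by move=> n v Mn; rewrite (periodic_grows_by perM') // cnt.
split=> //; last by exists M'.-1.
rewrite lt0n; apply/eqP => m0; apply: (@deadlock_free M'.-1 inh) => n v Mn.
apply/eqP; rewrite eqn_leq; apply/andP; split; last exact: leq_firings.
have := grows_by_iter (n - M'.-1) v gr (leqnn _).
rewrite /= m0 muln0 addn0 => <-; apply: leq_firings.
have : (n - M'.-1) * 1 <= (n - M'.-1) * period e c T by rewrite leq_mul2l p0 orbT.
lia.
Qed.

End FiringCounts.

(** * Colorings and potentials *)

Local Open Scope ring_scope.

Lemma circ_dist_itv (R : realType) (p x y : R) :
  0 <= x < p -> 0 <= y < p -> 0 <= circ_dist p x y < p.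
Proof.
move=> /andP[? ?] /andP[? ?]; rewrite /circ_dist.
by case: (lerP x y) => ?; apply/andP; split; lra.
Qed.

Lemma circ_dist_order (R : realType) (p x y : R) :
  circ_dist p x y = y - x + (y < x)%R%:R * p.
Proof. by rewrite /circ_dist; case: leP => _ /=; ring. Qed.

(** The condition on [uv] puts [d = y v - y u + T u v * p] above [c u v], and the
    one on [vu], with [T v u = 1 - T u v], puts it below [p - c v u]. So [d] is
    in [(0, p)] and congruent to [y v - y u], which makes it the clockwise
    distance between the residues of [y u] and [y v]. *)
Lemma potential_circular_coloring (R : realType) (V : finType) (e : rel V)
    (c : V -> V -> R) (T : V -> V -> nat) (p : R) (y : V -> R) :
  0 < p -> symmetric e -> (forall u v, e u v -> 0 < c u v) ->
  (forall u v, e u v -> (T u v + T v u)%N = 1%N) ->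
  (forall u v, e u v -> c u v <= y v - y u + (T u v)%:R * p) ->
  exists phi, circular_coloring e c p phi.
Proof.
move=> p0 e_sym c_pos T_sum pot.
pose fl v := Num.floor (y v / p).
pose phi v := y v - (fl v)%:~R * p.
have phiP v : 0 <= phi v < p.
  have /andP[] := Num.Theory.floor_itv (y v / p).
  rewrite ler_pdivlMr // ltr_pdivrMr // -/(fl v) intrD /phi => h1 h2.
  apply/andP; split; lra.
exists phi; split=> // u v euv.
have evu : e v u by rewrite e_sym.
have := pot u v euv; have := pot v u evu.
have := c_pos u v euv; have := c_pos v u evu.
have -> : T v u = (1 - T u v)%N by have := T_sum u v euv; lia.
rewrite natrB; last by have := T_sum u v euv; lia.
move=> cvu cuv h1 h2.
set d := y v - y u + (T u v)%:R * p in h2.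
have d0 : 0 < d by lra.
have dp : d < p by rewrite /d; lra.
have [k kE] : exists k : int, circ_dist p (phi u) (phi v) = d + k%:~R * p.
  exists (fl u - fl v - (T u v)%:Z + (if phi u <= phi v then 0 else 1)).
  rewrite /circ_dist /d /phi intrD !intrB -pmulrn.
  by case: ifP => _; ring.
have /andP[D0 Dp] := circ_dist_itv (phiP u) (phiP v).
rewrite kE in D0 Dp *.
have : (-1 : R) < k%:~R * p / p < 1.
  by rewrite ltr_pdivlMr // ltr_pdivrMr //; apply/andP; split; lra.
rewrite mulfK ?gt_eqF // -[-1]/((-1)%:~R) -[1]/(1%:~R) !ltr_int => kb.
have -> : k = 0 by lia.
by rewrite mul0r addr0.
Qed.

(** Averaging over a period turns the delay [c u v] into the amount
    [m * c u v] by which a sum of firing counts changes when its window moves. *)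
Lemma growth_coloring (R : realType) (V : finType) (e : rel V)
    (c : V -> V -> nat) (T : V -> V -> nat) (p m B : nat) :
  symmetric e -> (forall u v, e u v -> (0 < c u v)%N) -> good_marking e T ->
  (0 < p)%N -> (0 < m)%N -> grows_by e c T p (fun=> m) B ->
  exists phi : V -> R,
    circular_coloring e (fun u v => (c u v)%:R) (p%:R / m%:R) phi.
Proof.
move=> e_sym c_pos [_ T_sum] p0 m0 gr.
pose S n v := (\sum_(0 <= i < p) firings e c T (n + i) v)%N.
have SD k n v : (B <= n)%N -> S (n + k)%N v = (S n v + k * m)%N.
  elim: k => [|k IH] Bn; first by rewrite addn0 mul0n addn0.
  suff St j : (B <= j)%N -> S j.+1 v = (S j v + m)%N.
    by rewrite addnS St ?IH ?mulSn; lia.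
  move=> Bj; rewrite /S -(prednK p0) big_nat_recr // big_nat_recl //=.
  rewrite addSnnS (prednK p0) gr // addn0.
  under eq_bigr do rewrite addSnnS.
  lia.
(* the windows start at [B + K] so that they are still in the steady regime
   after being moved back by a weight *)
have [K cK] := weights_bounded c.
have mR : 0 < m%:R :> R by rewrite ltr0n.
pose y v : R := - (S (B + K)%N v)%:R / m%:R.
apply: (@potential_circular_coloring _ _ _ _ T _ y) => //.
- by rewrite divr_gt0 // ltr0n.
- by move=> u v /c_pos; rewrite ltr0n.
move=> u v euv.
have key : (S (B + K) v + c u v * m <= p * T u v + S (B + K) u)%N.
  have -> : (B + K = B + K - c u v + c u v)%N by have := cK u v; lia.
  rewrite [S _ u]SD; last by have := cK u v; lia.
  rewrite addnA leq_add2r /S.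
  have -> : (p * T u v = \sum_(0 <= i < p) T u v)%N.
    by rewrite sum_nat_const_nat subn0.
  rewrite -big_split /=; apply: leq_sum => i _.
  apply: leq_trans (firings_causal T c_pos _ euv) _.
  by rewrite leq_add2l; apply: leq_firings; lia.
rewrite /y -(ler_pM2r mR) mulrDl mulrBl !mulfVK ?gt_eqF // mulrA mulfVK ?gt_eqF //.
rewrite -(ler_nat R) !natrD !natrM in key.
lra.
Qed.

(** * From colorings to markings *)

Lemma coloring_marking_good (R : realType) (V : finType) (e : rel V)
    (c : V -> V -> R) (p : R) (phi : V -> R) (T : V -> V -> nat) :
  (forall u v, e u v -> 0 < c u v) -> circular_coloring e c p phi ->
  (forall u v, T u v = (phi v < phi u)) ->
  good_marking e T.
Proof.
move=> c_pos [_ col] TE; apply: order_marking_good TE => u v euv.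
apply/eqP => uv; have := lt_le_trans (c_pos u v euv) (col u v euv).
by rewrite uv /circ_dist lexx subrr ltxx.
Qed.

(** The firing number [k] of [v] waits for the firing number [k - T u v] of each
    in-neighbour [u]. That one is due at [phi u + (k - T u v) * p + 1], which is
    at most [phi v + k * p + 1 - c u v]. Firings are numbered from 0, and the
    extra 1 is there because time starts at 1. A vertex fires once per time unit
    at most, which is no obstacle as [1 <= p]. *)
Lemma coloring_schedule (R : realType) (V : finType) (e : rel V)
    (c : V -> V -> nat) (p : R) (phi : V -> R) (T : V -> V -> nat) :
  (forall u v, e u v -> (0 < c u v)%N) -> 1 <= p ->
  circular_coloring e (fun u v => (c u v)%:R) p phi ->
  (forall u v, T u v = (phi v < phi u)) ->
  forall n k v, phi v + k%:R * p + 1 <= n%:R -> (k < firings e c T n v)%N.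
Proof.
move=> c_pos p1 [phiP col] TE; elim/ltn_ind => n IH k v.
case: n IH => [|n] IH hn.
  have /andP[v0 _] := phiP v.
  have : 0 <= k%:R * p by rewrite mulr_ge0 //; lra.
  by move: hn; lra.
have kn : (k <= firings e c T n v)%N.
  case: k hn => // k hn; apply: IH => //.
  by move: hn; rewrite -!natr1; lra.
rewrite firingsS; move: kn; rewrite leq_eqVlt => /orP[/eqP kn|kn]; last first.
  by rewrite ltn_addr.
suff -> : firing e c T n v by rewrite -kn addn1.
apply: firing_enabled => // u euv; rewrite -kn.
have [kT|Tk] := ltnP k (T u v); first by rewrite ltn_addr.
have := col u v euv; rewrite circ_dist_order -TE => cuv.
have /andP[u0 _] := phiP u.
have kTp : 0 <= (k - T u v)%:R * p by rewrite mulr_ge0 //; lra.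
rewrite -ltn_subLR // ; apply: IH; first by have := c_pos u v euv; lia.
have cn : (c u v <= n.+1)%N.
  rewrite -(ler_nat R); move: kTp; rewrite natrB //; lra.
by rewrite !natrB //; lra.
Qed.

Lemma growth_le_perimeter (R : realType) (V : finType) (e : rel V)
    (c : V -> V -> nat) (p : R) (phi : V -> R) (T : V -> V -> nat)
    (q m B : nat) :
  (exists u v, e u v) -> (forall u v, e u v -> (0 < c u v)%N) ->
  circular_coloring e (fun u v => (c u v)%:R) p phi ->
  (forall u v, T u v = (phi v < phi u)) ->
  (0 < m)%N -> grows_by e c T q (fun=> m) B ->
  q%:R / m%:R <= p.
Proof.
move=> [v [w evw]] c_pos col TE m0 gr; have [phiP dist] := col.
have p1 : 1 <= p.
  have /andP[_] := circ_dist_itv (phiP v) (phiP w); have := dist v w evw.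
  have : 1 <= (c v w)%:R :> R by rewrite ler1n c_pos.
  lra.
rewrite ler_pdivrMr ?ltr0n // leNgt; apply/negP => lt_q.
(* after [j] periods [v] has fired [D + j * m] times, so its next firing is not
   due yet; this bounds every multiple of [q - p * m] *)
pose D := firings e c T B v.
have h j : j%:R * (q%:R - p * m%:R) < phi v + D%:R * p + 1.
  rewrite ltNge; apply/negP => hj.
  have /(coloring_schedule c_pos p1 col TE) :
      phi v + (D + j * m)%:R * p + 1 <= (B + j * q)%:R.
    rewrite !natrD !natrM; have : 0 <= B%:R :> R by [].
    lra.
  by rewrite (grows_by_iter _ _ gr) // ltnn.
pose X := (phi v + D%:R * p + 1) / (q%:R - p * m%:R).
have /andP[v0 _] := phiP v.
have X0 : 0 <= X.
  have Dp : 0 <= D%:R * p by rewrite mulr_ge0 //; lra.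
  by rewrite divr_ge0 //; lra.
have := archi_boundP X0; rewrite /X ltr_pdivrMr ?subr_gt0 //.
by move=> hX; have := lt_trans hX (h _); rewrite ltxx.
Qed.

Theorem theorem6 (R : realType) (V : finType) (e : rel V) (c : V -> V -> nat)
    (e_irr : irreflexive e) (e_sym : symmetric e)
    (e_conn : weakly_connected e) (e_arc : exists u v, e u v)
    (c_pos : forall u v, e u v -> (0 < c u v)%N) :
  let chi : R := circular_chromatic_number e (fun u v => (c u v)%:R) in
  let ratio (T : V -> V -> nat) : R :=
    (period e c T)%:R / (multiplicity e c T)%:R in
  (exists2 T, good_marking e T & chi = ratio T) /\
  (forall T, good_marking e T -> chi <= ratio T).
Proof.
move=> chi ratio.
have inh : inhabited V by case: e_arc => u _; exists.
pose P := [set p : R | 0 < p /\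
  exists phi, circular_coloring e (fun u v => (c u v)%:R) p phi]%classic.
have chiE : chi = inf P by [].
have P_ratio T : good_marking e T -> P (ratio T).
  move=> T_good.
  have [q0 m0 [B gr]] := game_growth c_pos e_sym T_good e_conn inh.
  split; first by rewrite divr_gt0 ?ltr0n.
  exact: growth_coloring gr.
have chi_le T : good_marking e T -> chi <= ratio T.
  move=> T_good; rewrite chiE; apply: ge_inf; last exact: P_ratio.
  by exists 0 => p [/ltW].
split=> //.
(* the markings given by colorings take the values 0 and 1 only, which leaves
   finitely many to minimize over *)
pose mark (f : {ffun V * V -> bool}) u v : nat := f (u, v).
have rank_good :
    good_marking e (mark [ffun x => (enum_rank x.2 < enum_rank x.1)%O]).
  apply: (order_marking_good (phi := enum_rank)) => [u v|u v].
    by apply: contraTneq => /enum_rank_inj ->; rewrite e_irr.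
  by rewrite /mark ffunE.
have /asboolP rank_goodb := rank_good.
have [f /asboolP f_good f_min] :=
  Order.TotalTheory.arg_minP (P := fun f => `[< good_marking e (mark f) >])
    (fun f => ratio (mark f)) rank_goodb.
exists (mark f) => //; apply/le_anti; rewrite chi_le //= chiE.
apply: lb_le_inf; first by exists (ratio (mark f)); apply: P_ratio.
move=> p [p0 [phi col]].
pose g := [ffun x : V * V => phi x.2 < phi x.1].
have gE u v : mark g u v = (phi v < phi u) by rewrite /mark ffunE.
have g_good : good_marking e (mark g).
  apply: coloring_marking_good col gE => u v euv; first by rewrite ltr0n c_pos.
have [q0 m0 [B gr]] := game_growth c_pos e_sym g_good e_conn inh.
apply: le_trans (growth_le_perimeter e_arc c_pos col gE m0 gr).
by apply: f_min; apply/asboolP.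
Qed.
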